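(* Let $k\geq 3$ and $0<\epsilon<\frac{1}{k^{5k}2^{8k}}$. If $G$ is a $k$-uniform hypergraph on $n$ vertices with $\delta(G)\geq (1-\epsilon)\binom{n-1}{k-1}$, then $\mathrm{mc}_{k+1}(G)\geq \left(\frac{k}{k+1}-\sqrt{k^k\epsilon}\right)n$.
   Context: $\delta(G)$ is the minimum degree of $G$, i.e. the minimum over vertices $v$ of the number of edges containing $v$. A hypergraph is connected if its shadow graph (two vertices adjacent iff they lie in a common edge) is connected; a component is a maximal connected subhypergraph, and its order is its number of vertices. For an $r$-coloring $\chi$ of the edges of $H$, $\mathrm{mc}(H,\chi)$ is the largest order of a component of the subhypergraph formed by the edges of a single color, and $\mathrm{mc}_r(H)=\min_\chi \mathrm{mc}(H,\chi)$ over all $r$-colorings $\chi$.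
   Formalization: The formal theorem additionally assumes n ≥ k; for 2 ≤ n < k the hypergraph has no edges, the degree condition reads 0 ≥ 0, and the claimed lower bound fails (e.g. k = 3, n = 2, where every component has order at most 1). *)

(* Defs.v *)
From mathcomp Require Import all_boot.

Set Implicit Arguments.
Unset Strict Implicit.
Unset Printing Implicit Defensive.

(* A hypergraph on the vertex set T is given by its set of edges. *)
Section Hypergraph.
Variable T : finType.
Implicit Types (H : {set {set T}}) (S C : {set T}).

Definition uniform (k : nat) H : bool := [forall e in H, #|e| == k].

Definition degree H (v : T) : nat := #|[set e in H | v \in e]|.

(* The initial value #|H| bounds every degree, so it does not affect the
   minimum as soon as T is nonempty. *)
Definition min_degree H : nat := \big[minn/#|H|]_(v : T) degree H v.

Definition shadow H : rel T :=
  fun x y => (x != y) && [exists e in H, (x \in e) && (y \in e)].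

Definition induced H S : {set {set T}} := [set e in H | e \subset S].

(* The subhypergraph of H with vertex set S and all edges of H inside S is
   connected.  Paths cannot leave S, since these edges lie inside S. *)
Definition connected_on H S : bool :=
  (S != set0) &&
  [forall x in S, forall y in S, connect (shadow (induced H S)) x y].

(* C is the vertex set of a component of H.  A maximal connected subhypergraph
   contains every edge of H inside its vertex set, so it is determined by C.
   A vertex lying in no edge forms a component of order 1. *)
Definition component H C : bool := maxset (connected_on H) C.

Section Coloring.
Variable r : nat.

(* Only the colors of the edges of H matter. *)
Definition color_class H (chi : {ffun {set T} -> 'I_r}) (i : 'I_r) :=
  [set e in H | chi e == i].

Definition mc H (chi : {ffun {set T} -> 'I_r}) : nat :=
  \max_(i < r) \max_(C : {set T} | component (color_class H chi i) C) #|C|.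

End Coloring.

(* The initial value #|T| bounds every mc H chi, so it does not affect the
   minimum as soon as r > 0. *)
Definition mcr (r : nat) H : nat :=
  \big[minn/#|T|]_(chi : {ffun {set T} -> 'I_r}) mc H chi.

End Hypergraph.

(* Main.v *)
(* Give each vertex the word of its k+1 monochromatic components.  If all
   components have order at most M < (k/(k+1) - sqrt(k^k eps)) n and the words
   of u and v agree in at most k-2 colors, then adding to {u, v} one vertex
   outside each common component gives a non-edge.  The degree of u leaves room
   for few non-edges, so each word is at Hamming distance at most 2 from all but
   b words, with 4 b <= sqrt(k^k eps) n.  As k+1 >= 4, and no letter is dominant
   in its coordinate, this forces all but 4 b words into a ball of radius 1
   around some center.  Each of the k+1 coordinates has at least n - M words
   differing from the center, so (k+1)(n - M) <= n + 4 (k+1) b, which is a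
   contradiction. *)

Require Import Defs.
From mathcomp Require Import all_boot all_order all_algebra.
From mathcomp Require Import reals.
From mathcomp Require Import zify ring lra.
Import Order.TTheory GRing.Theory Num.Theory.
Local Open Scope ring_scope.

(** * Words at Hamming distance at most 2 and their center *)

Definition hdist {I : finType} {X : eqType} (a b : I -> X) : nat :=
  #|[set i | a i != b i]|.

Lemma hdist_le2 (I : finType) (X : eqType) (a b : I -> X) (i j l : I) :
  (hdist a b <= 2)%N -> i != j -> i != l -> j != l ->
  a i != b i -> a j != b j -> a l = b l.
Proof.
move=> le2 ij il jl ai aj; apply/eqP/negPn/negP=> al.
suff: (2 < hdist a b)%N by rewrite ltnNge le2.
rewrite /hdist; apply: (@leq_trans #|[set i; j; l]|).
  by rewrite setUC !cardsU1 !inE cards1 negb_or eq_sym il eq_sym jl ij.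
apply/subset_leq_card/subsetP=> x; rewrite !inE.
by case/orP=> [/orP[]|] /eqP->.
Qed.

Lemma hdistC (I : finType) (X : eqType) (a b : I -> X) : hdist a b = hdist b a.
Proof. by apply: eq_card => i; rewrite !inE eq_sym. Qed.

(* Two of the four directions of the star avoid any two given coordinates at
   which z and c differ, and there z has to follow the corresponding words. *)
Lemma hdist_le1_of_star (I : finType) (X : eqType) (c z : I -> X)
    (x : 'I_4 -> I -> X) (d : 'I_4 -> I) :
  injective d ->
  (forall s, x s (d s) != c (d s)) ->
  (forall s j, j != d s -> x s j = c j) ->
  (forall s, (hdist (x s) z <= 2)%N) -> (hdist z c <= 1)%N.
Proof.
move=> dI xd xc xz; rewrite leqNgt; apply/negP=> /card_gt1P[p [q []]].
rewrite !inE => zp zq pq.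
have zd s : d s != p -> d s != q -> z (d s) = x s (d s).
  move=> sp sq; apply/esym/(hdist_le2 _ _ _ _ p q _ (xz s)) => //.
  - by rewrite eq_sym.
  - by rewrite eq_sym.
  - by rewrite xc 1?eq_sym // eq_sym.
  - by rewrite xc 1?eq_sym // eq_sym.
have : (1 < #|[set s | (d s != p) && (d s != q)]|)%N.
  have := cardsC [set s | (d s != p) && (d s != q)]; rewrite card_ord.
  have : (#|~: [set s | (d s != p) && (d s != q)]| <= 2)%N.
    rewrite -(card_imset _ dI); apply: (@leq_trans #|[set p; q]|).
      apply/subset_leq_card/subsetP=> y /imsetP[s]; rewrite !inE => h ->.
      by move: h; rewrite negb_and !negbK.
    by rewrite cards2; case: (p != q).
  lia.
case/card_gt1P=> s [t []]; rewrite !inE => /andP[sp sq] /andP[tp tq] st.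
(* Off [p] and [q] the word [z] follows both [x s] and [x t], but at [d t] the first equals [c] and
   the second does not. *)
have dst : d t != d s by rewrite (inj_eq dI) eq_sym.
have := xd t; rewrite -(zd t tp tq) -(xc s _ dst).
rewrite (hdist_le2 _ _ _ _ p q (d t) (xz s)) ?eqxx //.
- by rewrite eq_sym.
- by rewrite eq_sym.
- by rewrite xc 1?eq_sym // eq_sym.
- by rewrite xc 1?eq_sym // eq_sym.
Qed.

(** The difference at [l] uses one of the two that each distance bound allows. At each of [i] and
    [j] the word [w] differs from [u] or from [v], which uses up the other one, so [w] mixes [u] and
    [v] there and follows [u] elsewhere. *)
Lemma hdist_le2_between (I : finType) (X : eqType) (u v w : I -> X)
    (i j l : I) :
  i != j -> l != i -> l != j -> u i != v i -> u j != v j ->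
  u l = v l -> (hdist u w <= 2)%N -> (hdist v w <= 2)%N -> u l != w l ->
  (w i = u i /\ w j = v j \/ w i = v i /\ w j = u j)
  /\ forall q, q != i -> q != j -> q != l -> w q = u q.
Proof.
move=> ij li lj ui uj ul uw vw wl.
have vl : v l != w l by rewrite -ul.
have Hu p q : p != l -> q != l -> p != q -> u p != w p -> u q = w q.
  move=> pl ql pq up.
  by apply: (hdist_le2 _ _ _ _ p l q uw) => //; rewrite eq_sym.
have Hv p q : p != l -> q != l -> p != q -> v p != w p -> v q = w q.
  move=> pl ql pq up.
  by apply: (hdist_le2 _ _ _ _ p l q vw) => //; rewrite eq_sym.
have il : i != l by rewrite eq_sym.
have jl : j != l by rewrite eq_sym.
have ji : j != i by rewrite eq_sym.
have [ei|ni] := eqVneq (u i) (w i).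
  have vi : v i != w i by rewrite -ei eq_sym.
  have ej := Hv _ _ il jl ij vi.
  have nj : u j != w j by rewrite -ej.
  split; first by left.
  by move=> q qi qj ql; rewrite -(Hu j q) // eq_sym.
have ej := Hu _ _ il jl ij ni.
have vj : v j != w j by rewrite -ej eq_sym.
have ei := Hv _ _ jl il ji vj.
split; first by right.
by move=> q qi qj ql; rewrite -(Hu i q) // eq_sym.
Qed.

Lemma exists_in_setD (T : finType) (A B : {set T}) :
  (#|B| < #|A|)%N -> exists2 x, x \in A & x \notin B.
Proof.
move=> lt; apply/exists_inP; apply: contraLR lt; rewrite negb_exists_in -leqNgt.
move=> /forall_inP h; apply/subset_leq_card/subsetP=> x /h.
by rewrite negbK.
Qed.

(* If some pair is at distance exactly 2, it forms, with two words that leave it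
   in further directions, a star of four words around the center. *)
Lemma exists_center (T I : finType) (X : eqType) (L : T -> I -> X) (b d : nat) :
  (0 < #|T|)%N -> (3 < #|I|)%N -> (4 * b < d)%N ->
  (forall u, #|[set v | (2 < hdist (L u) (L v))%N]| <= b)%N ->
  (forall i x, d <= #|[set v | L v i != x]|)%N ->
  exists c : I -> X, (#|[set v | (1 < hdist (L v) c)%N]| <= 4 * b)%N.
Proof.
move=> /card_gt0P[u _] I4 bd Hb Hd.
pose B x := [set v | (2 < hdist (L x) (L v))%N].
have [/forallP near|] := boolP [forall v, (v \in B u) || (hdist (L v) (L u) <= 1)%N].
  exists (L u); apply: (@leq_trans b); last by lia.
  apply: leq_trans (Hb u); apply/subset_leq_card/subsetP=> v; rewrite !inE.
  by have := near v; rewrite !inE; case/orP=> //; rewrite leqNgt => /negPf->.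
rewrite negb_forall => /existsP[v]; rewrite inE negb_or -leqNgt -ltnNge => /andP[uv2 vu1].
have /eqP/cards2P[i [j [ij Eij]]] : hdist (L u) (L v) = 2%N.
  by apply/eqP; rewrite eqn_leq uv2 hdistC.
have diff p : (L u p != L v p) = (p == i) || (p == j).
  by move/setP/(_ p): Eij; rewrite !inE.
have ui : L u i != L v i by rewrite diff eqxx.
have uj : L u j != L v j by rewrite diff eqxx orbT.
have same p : p != i -> p != j -> L u p = L v p.
  by move=> pi pj; apply/eqP; rewrite -[_ == _]negbK diff negb_or pi pj.
have [p [q [/andP[pi pj] /andP[qi qj] pq]]] :
    exists p q, [/\ (p != i) && (p != j), (q != i) && (q != j) & p != q].
  have : (1 < #|~: [set i; j]|)%N.
    by have := cardsC [set i; j]; rewrite cards2 ij; lia.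
  case/card_gt1P=> p [q []]; rewrite !inE !negb_or => hp hq pq.
  by exists p, q.
(* At most [2 * b < d] words are far from [u] or [v], so one that is near both leaves [u] at [p].
   For [w'] three exclusions cost at most [3 * b < d]. *)
have [w wp wB] : exists2 w, w \in [set v | L v p != L u p] & w \notin B u :|: B v.
  apply: exists_in_setD; have := Hd p (L u p); have := Hb u; have := Hb v.
  by have := (leq_card_setU (B u) (B v)).1; rewrite /B; lia.
have [w' wq wB'] : exists2 w', w' \in [set v | L v q != L u q]
    & w' \notin B u :|: B v :|: B w.
  apply: exists_in_setD; have := Hd q (L u q).
  have := Hb u; have := Hb v; have := Hb w.
  have := (leq_card_setU (B u) (B v)).1.
  by have := (leq_card_setU (B u :|: B v) (B w)).1; rewrite /B; lia.
move: wp wB wq wB'; rewrite !inE !negb_or -!leqNgt ![_ == L u _]eq_sym.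
move=> wp /andP[uw vw] wq /andP[/andP[uw' vw'] ww'].
have [ww wu] := hdist_le2_between _ _ _ _ _ _ _ _ ij pi pj ui uj (same _ pi pj) uw vw wp.
have [ww0 wu'] := hdist_le2_between _ _ _ _ _ _ _ _ ij qi qj ui uj (same _ qi qj) uw' vw' wq.
have qp : q != p by rewrite eq_sym.
(* A word within distance 2 of all four words of the star is within distance 1 of [c], so the
   exceptions lie in four sets of size at most [b]. *)
have star (c : I -> X) (x : 'I_4 -> T) (e : 'I_4 -> I) : injective e ->
    (forall s, L (x s) (e s) != c (e s)) ->
    (forall s l, l != e s -> L (x s) l = c l) ->
    exists c : I -> X, (#|[set v | (1 < hdist (L v) c)%N]| <= 4 * b)%N.
  move=> eI xe xc; exists c.
  apply: (@leq_trans #|\bigcup_(s : 'I_4) B (x s)|).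
    apply/subset_leq_card/subsetP=> z; rewrite inE => zc.
    apply/negPn/negP=> /bigcupP nz; move: zc; rewrite ltnNge.
    rewrite (hdist_le1_of_star _ _ c (L z) (fun s => L (x s)) e) // => s.
    by rewrite leqNgt; apply/negP=> bad; apply: nz; exists s; rewrite ?inE.
  apply: (@leq_trans (\sum_(s < 4) #|B (x s)|)%N).
    elim/big_rec2: _ => [|s m A _ Am]; first by rewrite cards0.
    by apply: leq_trans (leq_card_setU _ _).1 _; rewrite leq_add2l.
  have -> : (4 * b = \sum_(s < 4) b)%N by rewrite sum_nat_const card_ord.
  by apply: leq_sum => s _; apply: Hb.
have ji : j != i by rewrite eq_sym.
(* [w] and [w'] differ at [p] and at [q], hence agree elsewhere and mix [u] and [v] on [i], [j] in
   the same way. *)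
have nww i' : i' != p -> i' != q -> L w i' = L w' i'.
  move=> ip iq; apply: (hdist_le2 _ _ _ _ p q _ ww'); rewrite 1?[_ == i']eq_sym //.
  - by rewrite (wu' p) // eq_sym.
  - by rewrite (wu q).
have iw : L w i = L w' i by apply: nww; rewrite eq_sym.
have jw : L w j = L w' j by apply: nww; rewrite eq_sym.
pose e (s : 'I_4) := nth i [:: i; j; p; q] s.
have eI : injective e.
  move=> s t /eqP; rewrite /e nth_uniq //= ?inE.
    by move/eqP/val_inj.
  by rewrite !negb_or ij pq ![_ == p]eq_sym ![_ == q]eq_sym pi pj qi qj.
pose x a a' (s : 'I_4) := nth u [:: a; a'; w; w'] s.
(* The center is this common mix. One of [u], [v] leaves it at [i] and the other at [j], depending
   on the case, while [w] leaves it at [p] and [w'] at [q]. *)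
case: ww => [] [wi wj].
  have wi' := esym iw; have wj' := esym jw; rewrite wi in wi'; rewrite wj in wj'.
  pose c l := if l == j then L v j else L u l.
  apply: (star c (x v u) e eI).
    case=> [[|[|[|[|//]]]]] lt; rewrite /e /x /c /=.
    - by rewrite (negPf ij) eq_sym.
    - by rewrite eqxx.
    - by rewrite (negPf pj) eq_sym.
    - by rewrite (negPf qj) eq_sym.
  case=> [[|[|[|[|//]]]]] lt l; rewrite /e /x /c /= => ls;
    (have [lj|lj] := eqVneq l j; first by move: ls; rewrite lj ?eqxx).
  - by rewrite same.
  - by [].
  - by have [->//|li] := eqVneq l i; apply: wu.
  - by have [->//|li] := eqVneq l i; apply: wu'.
have wi' := esym iw; have wj' := esym jw; rewrite wi in wi'; rewrite wj in wj'.
pose c l := if l == i then L v i else L u l.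
apply: (star c (x u v) e eI).
  case=> [[|[|[|[|//]]]]] lt; rewrite /e /x /c /=.
  - by rewrite eqxx.
  - by rewrite (negPf ji) eq_sym.
  - by rewrite (negPf pi) eq_sym.
  - by rewrite (negPf qi) eq_sym.
case=> [[|[|[|[|//]]]]] lt l; rewrite /e /x /c /= => ls;
  (have [li|li] := eqVneq l i; first by move: ls; rewrite li ?eqxx).
- by [].
- by rewrite same.
- by have [->//|lj] := eqVneq l j; apply: wu.
- by have [->//|lj] := eqVneq l j; apply: wu'.
Qed.

(** Double counting of the distances to a center: every coordinate contributes at least [d], a word
    within distance 1 at most 1, and each of the at most [4 * b] others at most [#|I|]. For
    [d <= 4 * b] the last term alone suffices. *)
Lemma card_le_of_near_words (T I : finType) (X : eqType) (L : T -> I -> X)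
    (b d : nat) :
  (0 < #|T|)%N -> (3 < #|I|)%N ->
  (forall u, #|[set v | (2 < hdist (L u) (L v))%N]| <= b)%N ->
  (forall i x, d <= #|[set v | L v i != x]|)%N ->
  (#|I| * d <= #|T| + 4 * #|I| * b)%N.
Proof.
move=> T0 I4 Hb Hd; have [bd|db] := ltnP (4 * b) d; last first.
  by apply: leq_trans (leq_addl _ _); rewrite -mulnA mulnCA leq_mul2l db orbT.
have [c Hc] := exists_center _ _ _ _ _ _ T0 I4 bd Hb Hd.
apply: (@leq_trans (\sum_v hdist (L v) c)%N).
  rewrite -sum_nat_const; under [leqRHS]eq_bigr do rewrite /hdist -sum1dep_card.
  rewrite (exchange_big_dep predT) //=; apply: leq_sum => i _.
  by rewrite sum1dep_card Hd.
apply: (@leq_trans (\sum_v (1 + #|I| * (1 < hdist (L v) c)))%N).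
  apply: leq_sum => v _; case: ltnP => h; last by rewrite muln0.
  by rewrite muln1 (leq_trans (max_card _)) ?leqnSn.
rewrite big_split /= sum1_card -big_distrr /= leq_add2l.
have -> : (\sum_v (1 < hdist (L v) c) = #|[set v | (1 < hdist (L v) c)%N]|)%N.
  by rewrite -sum1dep_card [RHS]big_mkcond.
by rewrite [(4 * _)%N]mulnC -mulnA leq_mul2l Hc orbT.
Qed.

(** * Non-edges obtained by splitting every color *)

Definition nonedges {T : finType} (k : nat) (G : {set {set T}}) (A : {set T}) :
    {set {set T}} :=
  [set e : {set T} | [&& #|e| == k, e \notin G & A \subset e]].

(** Count the pairs of [w] in [W] and a non-edge containing [w] and [A] in two ways: such a non-edge
    has only [k - #|A|] vertices outside [A]. *)
Lemma sum_card_nonedges (T : finType) (k : nat) (G : {set {set T}})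
    (A W : {set T}) :
  [disjoint A & W] ->
  (\sum_(w in W) #|nonedges k G (w |: A)| <= (k - #|A|) * #|nonedges k G A|)%N.
Proof.
move=> AW.
have eqn w : #|nonedges k G (w |: A)| = (\sum_(e in nonedges k G A) (w \in e))%N.
  rewrite -sum1_card [LHS]big_mkcond [RHS]big_mkcond; apply: eq_bigr => e _.
  rewrite !inE subUset sub1set.
  by case: (#|e| == k); case: (e \notin G); case: (w \in e); case: (A \subset e).
under eq_bigr do rewrite eqn.
rewrite exchange_big /= mulnC -sum_nat_const; apply: leq_sum => e.
rewrite inE => /and3P[/eqP <- _ Ae].
have <- : #|[set w in W | w \in e]| = (\sum_(w in W) (w \in e))%N.
  rewrite -sum1_card big_mkcond [RHS]big_mkcond; apply: eq_bigr => w _.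
  by rewrite inE; case: (w \in W); case: (w \in e).
rewrite -(setIidPr Ae) -cardsD; apply/subset_leq_card/subsetP=> w.
rewrite !inE => /andP[wW ->]; rewrite andbT.
by apply: contraL wW => /(disjointFr AW) ->.
Qed.

(** With [L x i] the component of [x] in color [i], an edge is not split in its own color, so a
    [k]-set split in all colors is a non-edge. *)
Definition split_by {T I : finType} {X : eqType} (L : T -> I -> X) (i : I)
    (A : {set T}) : bool :=
  [exists x in A, exists y in A, L x i != L y i].

Lemma split_byS (T I : finType) (X : eqType) (L : T -> I -> X) (i : I)
    (A B : {set T}) :
  A \subset B -> split_by L i A -> split_by L i B.
Proof.
move=> /subsetP AB /exists_inP[x xA /exists_inP[y yA xy]].
by apply/exists_inP; exists x; [exact: AB|apply/exists_inP; exists y; [exact: AB|]].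
Qed.

Lemma split_by_pair (T I : finType) (X : eqType) (L : T -> I -> X) (i : I)
    (A : {set T}) (u w : T) :
  u \in A -> L w i != L u i -> split_by L i (w |: A).
Proof.
move=> uA wu; apply/exists_inP; exists w; first by rewrite setU11.
by apply/exists_inP; exists u; rewrite // setU1r.
Qed.

(** For each color of [cs] in turn, add to [A] a vertex whose letter there differs from that of [u].
    Each step has at least [m] choices, and the factorial accounts for the orders in which the same
    non-edge arises. *)
Lemma card_nonedges_ge (T I : finType) (X : eqType) (L : T -> I -> X) (k m : nat)
    (G : {set {set T}}) (u : T) (cs : seq I) (A : {set T}) :
  (forall e, e \in G -> exists i, ~~ split_by L i e) ->
  (forall i, m + k <= #|[set v | L v i != L u i]|)%N ->
  u \in A -> (#|A| + size cs = k)%N ->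
  (forall i, i \notin cs -> split_by L i A) ->
  (m ^ size cs <= #|nonedges k G A| * (size cs)`!)%N.
Proof.
move=> mono Hm; elim: cs A => [|i cs IH] A uA /= Ak spl.
  rewrite expn0 fact0 muln1 card_gt0; apply/set0Pn; exists A.
  rewrite inE subxx andbT -{1}Ak addn0 eqxx /=; apply/negP=> AG.
  by have [i] := mono _ AG; rewrite spl.
(* At most [k] candidates already lie in [A]; the summand [k] in [Hm] pays for them. *)
pose W := [set v | L v i != L u i] :\: A.
have Wm : (m <= #|W|)%N.
  rewrite cardsD; have := Hm i.
  have := subset_leq_card (subsetIr [set v | L v i != L u i] A); lia.
have step w : w \in W ->
    (m ^ size cs <= #|nonedges k G (w |: A)| * (size cs)`!)%N.
  rewrite !inE => /andP[wA wi]; apply: IH; first by rewrite setU1r.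
    by rewrite cardsU1 wA; lia.
  move=> j jcs; have [->|ji] := eqVneq j i; first exact: split_by_pair wi.
  by apply: split_byS (subsetU1 _ _) (spl j _); rewrite inE negb_or ji.
have AW : [disjoint A & W] by rewrite disjoint_sym disjoints_subset /W setDE subsetIr.
have kA : (k - #|A| = (size cs).+1)%N by lia.
have := sum_card_nonedges _ k G A W AW; rewrite kA => sumW.
rewrite expnS factS mulnA; apply: (@leq_trans (#|W| * m ^ size cs)%N).
  by rewrite leq_mul2r Wm orbT.
rewrite -sum_nat_const; apply: (@leq_trans
  (\sum_(w in W) #|nonedges k G (w |: A)| * (size cs)`!)%N); first exact: leq_sum.
by rewrite -big_distrl /= leq_mul2r [X in (_ <= X)%N]mulnC sumW orbT.
Qed.

(** Existence without counting, for small vertex sets. A chosen vertex may already lie in [A], hence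
    the inequality between the sizes. *)
Lemma nonedges_gt0 (T I : finType) (X : eqType) (L : T -> I -> X) (k : nat)
    (G : {set {set T}}) (u : T) (cs : seq I) (A : {set T}) :
  (forall e, e \in G -> exists i, ~~ split_by L i e) ->
  (forall i, 0 < #|[set v | L v i != L u i]|)%N ->
  u \in A -> (#|A| + size cs <= k)%N -> (k <= #|T|)%N ->
  (forall i, i \notin cs -> split_by L i A) ->
  (0 < #|nonedges k G A|)%N.
Proof.
move=> mono Hm uA Ak kT; elim: cs A uA Ak => [|i cs IH] A uA /= Ak spl.
  (* All colors are split by now, so [A] can be filled up to [k] elements with arbitrary
     vertices. *)
  have [s [ss su sA]] : exists s : seq T, [/\ size s = k, uniq s & {subset A <= s}].
    exists (take k (enum A ++ enum (~: A))).
    have sz : size (enum A ++ enum (~: A)) = #|T|.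
      by rewrite size_cat -!cardE cardsC.
    split; first by rewrite size_take_min sz; apply/minn_idPl.
      apply: take_uniq; rewrite cat_uniq !enum_uniq andbT /=.
      by apply/hasPn=> x; rewrite !mem_enum inE.
    rewrite addn0 in Ak.
    by move=> x xA; rewrite take_cat -cardE ltnNge Ak mem_cat mem_enum xA.
  rewrite card_gt0; apply/set0Pn; exists [set x in s].
  have As : A \subset [set x in s] by apply/subsetP=> x /sA; rewrite inE.
  rewrite inE As cardsE (card_uniqP su) ss eqxx andbT /=; apply/negP=> sG.
  by have [i] := mono _ sG; rewrite (split_byS _ _ _ _ _ _ _ As) ?spl.
have /card_gt0P[w] := Hm i; rewrite inE => wi.
have : (0 < #|nonedges k G (w |: A)|)%N.
  apply: IH; first by rewrite setU1r.
    by rewrite cardsU1; case: (w \notin A) => /=; lia.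
  move=> j jcs; have [->|ji] := eqVneq j i; first exact: split_by_pair wi.
  by apply: split_byS (subsetU1 _ _) (spl j _); rewrite inE negb_or ji.
rewrite !card_gt0 => /set0Pn[e]; rewrite inE => /and3P[ek eG Ae].
apply/set0Pn; exists e; rewrite inE ek eG /=.
exact: subset_trans (subsetU1 _ _) Ae.
Qed.

(** The list of agreeing coordinates is padded with copies of [i0], because [card_nonedges_ge] needs
    its exact length. *)
Lemma hdist_agree_seq (I : finType) (X : eqType) (a b : I -> X) (s : nat) (i0 : I) :
  (#|I| - hdist a b <= s)%N ->
  exists2 cs : seq I, size cs = s & forall i, i \notin cs -> a i != b i.
Proof.
move=> le; exists (enum [set i | a i == b i] ++ nseq (s - #|[set i | a i == b i]|) i0).
  rewrite size_cat size_nseq -cardE subnKC //; apply: leq_trans le.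
  rewrite -(cardsC [set i | a i == b i]) /hdist.
  suff -> : ~: [set i | a i == b i] = [set i | a i != b i] by rewrite addnK.
  by apply/setP=> i; rewrite !inE.
by move=> i; rewrite mem_cat negb_or mem_enum inE => /andP[].
Qed.

(** At most [k - 2] of the [k + 1] coordinates agree, and [k - 2] is the number of vertices that
    complete the pair to a [k]-set. *)
Lemma split_by_pair_of_hdist (T I : finType) (X : eqType) (L : T -> I -> X)
    (k : nat) (u v : T) :
  #|I| = k.+1 -> (2 < k)%N -> (2 < hdist (L u) (L v))%N ->
  exists2 cs : seq I, size cs = (k - 2)%N
    & forall i, i \notin cs -> split_by L i [set v; u].
Proof.
move=> Ik k3 uv.
have /card_gt0P[i0 _] : (0 < #|I|)%N by rewrite Ik.
have [|cs cs2 csP] := hdist_agree_seq _ _ (L u) (L v) (k - 2) i0; first by lia.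
exists cs => // i /csP; rewrite eq_sym; apply: split_by_pair; exact: set11.
Qed.

(** Each far [v] lies with [u] in at least [m ^ (k - 2) / (k - 2)!] non-edges. A non-edge through
    [u] is counted for at most [k - 1] such [v], which turns [(k - 2)!] into [(k - 1)!]. *)
Lemma card_far_le (T I : finType) (X : eqType) (L : T -> I -> X) (k m : nat)
    (G : {set {set T}}) (u : T) :
  #|I| = k.+1 -> (2 < k)%N ->
  (forall e, e \in G -> exists i, ~~ split_by L i e) ->
  (forall i, m + k <= #|[set v | L v i != L u i]|)%N ->
  (#|[set v | (2 < hdist (L u) (L v))%N]| * m ^ (k - 2)
     <= #|nonedges k G [set u]| * (k - 1)`!)%N.
Proof.
move=> Ik k3 mono Hm; set B := [set v | _].
have uB : [disjoint [set u] & B].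
  rewrite disjoints1 inE -leqNgt /hdist; apply: leq_trans (_ : 0 <= _)%N => //.
  by rewrite leqn0 cards_eq0 -subset0; apply/subsetP=> i; rewrite !inE eqxx.
have bad v : v \in B ->
    (m ^ (k - 2) <= #|nonedges k G [set v; u]| * (k - 2)`!)%N.
  move=> vB; have := vB; rewrite inE => uv.
  have [cs cs2 csP] := split_by_pair_of_hdist _ _ _ L k u v Ik k3 uv.
  rewrite -cs2; apply: (card_nonedges_ge _ _ _ L _ _ _ u) => //.
    by rewrite !inE eqxx orbT.
  rewrite cs2 cards2; suff -> : v != u by lia.
  by apply: contraTneq vB => ->; rewrite (disjointFr uB) ?set11.
rewrite -sum_nat_const; apply: (@leq_trans
  (\sum_(v in B) #|nonedges k G [set v; u]| * (k - 2)`!)%N); first exact: leq_sum.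
rewrite -big_distrl /=; have := sum_card_nonedges _ k G [set u] B uB.
rewrite cards1 => le.
have -> : ((k - 1)`! = (k - 1) * (k - 2)`!)%N.
  by rewrite (_ : k - 1 = (k - 2).+1)%N ?factS //; lia.
by rewrite mulnA [(_ * (k - 1))%N]mulnC leq_mul2r le orbT.
Qed.

(** This serves small vertex sets, where the degree condition leaves no non-edge at [u]: a far
    vertex would produce one. *)
Lemma far_eq0 (T I : finType) (X : eqType) (L : T -> I -> X) (k : nat)
    (G : {set {set T}}) (u : T) :
  #|I| = k.+1 -> (2 < k)%N -> (k <= #|T|)%N ->
  (forall e, e \in G -> exists i, ~~ split_by L i e) ->
  (forall i, 0 < #|[set v | L v i != L u i]|)%N ->
  nonedges k G [set u] = set0 ->
  #|[set v | (2 < hdist (L u) (L v))%N]| = 0%N.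
Proof.
move=> Ik k3 kT mono Hm N0; apply/eqP; rewrite cards_eq0 -subset0.
apply/subsetP=> v; rewrite inE => uv.
have [cs cs2 csP] := split_by_pair_of_hdist _ _ _ L k u v Ik k3 uv.
have : (0 < #|nonedges k G [set v; u]|)%N.
  apply: (nonedges_gt0 _ _ _ L _ _ u cs) => //.
    by rewrite !inE eqxx orbT.
  by rewrite cs2 cards2; case: (v != u) => /=; lia.
rewrite card_gt0 => /set0Pn[e]; rewrite inE => /and3P[ek eG Ae].
suff : e \in nonedges k G [set u] by rewrite N0 inE.
by rewrite inE ek eG /=; apply: subset_trans Ae; rewrite subsetUr.
Qed.

(** * Monochromatic components as letters *)

Definition color_comp {T : finType} {r : nat} (G : {set {set T}})
    (chi : {ffun {set T} -> 'I_r}) (v : T) (i : 'I_r) : {set T} :=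
  [set w | connect (shadow (color_class G chi i)) v w].

Lemma shadow_sym (T : finType) (H : {set {set T}}) : symmetric (shadow H).
Proof.
move=> x y; rewrite /shadow eq_sym; congr (_ && _).
by apply: eq_existsb => e; rewrite [(x \in e) && _]andbC.
Qed.

Lemma component_connect (T : finType) (H : {set {set T}}) (v : T) :
  component H [set w | connect (shadow H) v w].
Proof.
set C := [set w | _].
apply/maxsetP; split.
  apply/andP; split; first by apply/set0Pn; exists v; rewrite inE connect0.
  (* A path from a vertex of [C] stays in [C] together with the edges that it uses, so it survives
     in the induced subhypergraph. *)
  have lift x y : x \in C -> connect (shadow H) x y ->
      connect (shadow (induced H C)) x y.
    move=> + /connectP[p]; elim: p x => [|z p IH] x xC /=; first by move=> _ ->.
    case/andP=> xz zp yE.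
    have vx : connect (shadow H) v x by rewrite inE in xC.
    have zC : z \in C by rewrite inE (connect_trans vx (connect1 xz)).
    apply: connect_trans (IH z zC zp yE); apply: connect1.
    case/andP: (xz) => nxz /exists_inP[e eH /andP[xe ze]].
    rewrite /shadow nxz; apply/exists_inP; exists e; last by rewrite xe.
    rewrite inE eH; apply/subsetP=> t te; rewrite inE.
    have [<-|xt] := eqVneq x t; first exact: vx.
    apply: connect_trans vx (connect1 _); rewrite /shadow xt.
    by apply/exists_inP; exists e; rewrite ?xe.
  apply/forall_inP=> x xC; apply/forall_inP=> y yC; apply: lift => //.
  rewrite !inE in xC yC; apply: connect_trans yC.
  by rewrite (sym_connect_sym (shadow_sym T H)).
move=> B /andP[_ /forall_inP Bc] CB; apply/eqP; rewrite eqEsubset CB andbT.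
have vB : v \in B by rewrite (subsetP CB) // inE connect0.
apply/subsetP=> y yB; rewrite inE.
have /forall_inP/(_ _ yB) := Bc _ vB.
apply: connect_sub => a b' /andP[ab /exists_inP[e]]; rewrite inE => /andP[eH _] h.
by apply: connect1; rewrite /shadow ab; apply/exists_inP; exists e.
Qed.

Lemma card_color_comp_le_mc (T : finType) (r : nat) (G : {set {set T}})
    (chi : {ffun {set T} -> 'I_r}) (v : T) (i : 'I_r) :
  (#|color_comp G chi v i| <= mc G chi)%N.
Proof.
rewrite /mc; apply: leq_trans (leq_bigmax i).
apply: (@leq_bigmax_cond _ _ (fun C : {set T} => #|C|)).
exact: component_connect.
Qed.

(** The vertices with letter [C] all lie in the component of any one of them, so there are at most
    [mc G chi] of them. *)
Lemma card_color_comp_neq (T : finType) (r : nat) (G : {set {set T}})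
    (chi : {ffun {set T} -> 'I_r}) (i : 'I_r) (C : {set T}) :
  (#|T| - mc G chi <= #|[set v | color_comp G chi v i != C]|)%N.
Proof.
rewrite -(cardsC [set v | color_comp G chi v i != C]).
suff: (#|~: [set v | color_comp G chi v i != C]| <= mc G chi)%N by lia.
have [->|/set0Pn[v]] := eqVneq (~: [set v | color_comp G chi v i != C]) set0.
  by rewrite cards0.
rewrite !inE negbK => /eqP vC.
apply: leq_trans (card_color_comp_le_mc _ _ G chi v i).
apply/subset_leq_card/subsetP=> w; rewrite !inE negbK -vC => /eqP/setP/(_ w).
by rewrite !inE connect0 => <-.
Qed.

Lemma not_split_by_color_comp (T : finType) (r : nat) (G : {set {set T}})
    (chi : {ffun {set T} -> 'I_r}) (e : {set T}) :
  e \in G -> exists i, ~~ split_by (color_comp G chi) i e.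
Proof.
move=> eG; exists (chi e); apply/negP=> /exists_inP[x xe /exists_inP[y ye]].
case/eqP; apply/setP=> z; rewrite !inE.
have [->//|xy] := eqVneq x y.
apply: (same_connect (sym_connect_sym (shadow_sym _ _))); apply: connect1.
by rewrite /shadow xy; apply/exists_inP; exists e; rewrite ?inE ?eG ?xe /=.
Qed.

(** * Non-edges at a vertex and its degree *)

Lemma card_nonedges_degree (T : finType) (k : nat) (G : {set {set T}}) (u : T) :
  (0 < k)%N -> uniform k G ->
  (#|nonedges k G [set u]| + degree G u = 'C(#|T| - 1, k - 1))%N.
Proof.
move=> k0 /forall_inP Gk.
have T0 : (0 < #|T|)%N by apply/card_gt0P; exists u.
pose K := [set e : {set T} | #|e| == k]; pose U := [set e : {set T} | u \in e].
have eN : K :\: ~: U :\: G = nonedges k G [set u].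
  apply/setP=> e; rewrite !inE sub1set negbK.
  by case: (e \in G); case: (u \in e); case: (#|e| == k).
have eD : (K :\: ~: U) :&: G = [set e in G | u \in e].
  apply/setP=> e; rewrite !inE negbK.
  by case: (boolP (e \in G)) => [/Gk->|_]; rewrite ?andbT ?andbF.
have eC : K :&: ~: U = [set e : {set T} | e \subset ~: [set u] & #|e| == k].
  apply/setP=> e; rewrite !inE andbC; congr (_ && _).
  by rewrite subsetC sub1set inE.
have := cardsID G (K :\: ~: U); rewrite eN eD => h.
have := cardsID (~: U) K; rewrite eC -h cards_draws card_draws cardsC1.
(* By Pascal's rule, removing the [k]-sets that avoid [u] leaves ['C(#|T| - 1, k - 1)] of them. *)
rewrite -(prednK T0) -(prednK k0) binS /degree !subn1 /=; lia.
Qed.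

Lemma min_degree_le (T : finType) (G : {set {set T}}) (u : T) :
  (min_degree G <= degree G u)%N.
Proof.
rewrite /min_degree; have : u \in index_enum T by rewrite mem_index_enum.
elim: (index_enum T) => // v s IH; rewrite inE big_cons geq_min.
by case/predU1P=> [->|/IH ->]; rewrite ?leqnn ?orbT.
Qed.

(** * Numerical estimates *)

Lemma bin_fact_le (n m : nat) : ('C(n, m) * m`! <= n ^ m)%N.
Proof.
rewrite bin_ffact; elim: m n => [|m IH] n; first by rewrite ffactn0.
rewrite ffactnS expnS leq_mul2l; apply/orP; right.
by apply: leq_trans (IH _) _; case: m {IH} => // m; rewrite leq_exp2r ?leq_pred.
Qed.

(** This makes [eps * 'C(n - 1, k - 1)] less than 1 for small [n]. It holds because
    [n - 1 <= 4 * k ^ 2]. *)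
Lemma bin_le_of_small (k n : nat) :
  (3 <= k)%N -> (n < 2 * k * (k + 1))%N ->
  ('C(n - 1, k - 1) <= k ^ (5 * k) * 2 ^ (8 * k))%N.
Proof.
move=> k3 small; apply: leq_trans (leq_pmulr _ (fact_gt0 (k - 1))) _.
apply: leq_trans (bin_fact_le _ _) _.
have k1 : (0 < k - 1)%N by lia.
have k0 : (0 < k)%N by lia.
apply: (@leq_trans ((2 ^ 2 * k ^ 2) ^ (k - 1))).
  by rewrite leq_exp2r // -!mulnn; nia.
apply: (@leq_trans ((2 ^ 2 * k ^ 2) ^ k)).
  by rewrite leq_pexp2l ?leq_subr // muln_gt0 !expn_gt0 k0.
rewrite expnMn -!expnM mulnC.
by apply: leq_mul; rewrite leq_pexp2l //; lia.
Qed.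

(** The left side is at most [eps * (4 * k) ^ k]. The square of this is [k ^ k * eps] times
    [eps * k ^ k * 2 ^ (4 * k)], and the bound on [eps] makes the last factor at most 1. *)
Lemma eps_pow_le_sqrt (R : realType) (k : nat) (eps : R) :
  (3 <= k)%N -> 0 < eps -> eps < 1 / (k%:R ^+ (5 * k) * 2%:R ^+ (8 * k)) ->
  4%:R * (eps * (2 * (k + 1))%:R ^+ (k - 2)) <= Num.sqrt (k%:R ^+ k * eps).
Proof.
move=> k3 e0.
have k1 : (1 : R) <= k%:R by rewrite ler1n; lia.
have k0 : (0 : R) < k%:R by apply: lt_le_trans k1.
have D0 : 0 < k%:R ^+ (5 * k) * 2%:R ^+ (8 * k) :> R.
  by rewrite mulr_gt0 ?exprn_gt0.
rewrite ltr_pdivlMr // => eD.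
have p0 : 0 <= 4%:R * k%:R :> R by rewrite mulr_ge0 ?ltW.
have le1 : 4%:R * (eps * (2 * (k + 1))%:R ^+ (k - 2)) <= eps * (4%:R * k%:R) ^+ k.
  rewrite mulrCA ler_pM2l //.
  have -> : (4%:R * k%:R : R) ^+ k = (4%:R * k%:R) ^+ 2 * (4%:R * k%:R) ^+ (k - 2).
    by rewrite -exprD; congr (_ ^+ _); lia.
  apply: ler_pM => //; first by rewrite exprn_ge0.
    by rewrite expr2; nra.
  rewrite lerXn2r ?nnegrE //.
  by rewrite -natrM ler_nat; lia.
apply: le_trans le1 _.
have e1 : 0 <= eps * (4%:R * k%:R) ^+ k by rewrite mulr_ge0 ?exprn_ge0 // ltW.
rewrite -[leLHS](ger0_norm e1) -sqrtr_sqr ler_wsqrtr //.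
have -> : (eps * (4%:R * k%:R) ^+ k) ^+ 2
    = (k%:R ^+ k * eps) * (eps * (k%:R ^+ k * 2%:R ^+ (4 * k))).
  have -> : 2%:R ^+ (4 * k) = 4%:R ^+ k * 4%:R ^+ k :> R.
    by rewrite -exprMn exprM; congr (_ ^+ _); rewrite -natrX -natrM.
  by rewrite !exprMn; move: (4%:R ^+ k) (k%:R ^+ k) => x y; ring.
rewrite ler_piMr ?mulr_ge0 ?exprn_ge0 ?ltW //.
apply: le_lt_trans eD; rewrite ler_pM2l //.
by apply: ler_pM; rewrite ?exprn_ge0 ?ler0n // ler_weXn2l ?ler1n //; lia.
Qed.

(* Here F is the number of words far from a given one, N the number of non-edges
   at that vertex and d = n - M. *)
Lemma le_of_large (R : realType) (k n d F N : nat) (eps : R) :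
  (3 <= k)%N -> (2 * k * (k + 1) <= n)%N -> 0 < eps ->
  n%:R <= (k + 1)%:R * d%:R :> R ->
  (F * (d - k) ^ (k - 2) <= N * (k - 1)`!)%N ->
  N%:R <= eps * 'C(n - 1, k - 1)%:R ->
  F%:R <= eps * n%:R * (2 * (k + 1))%:R ^+ (k - 2).
Proof.
move=> k3 large e0 nd le Nle.
have K0 : (0 : R) < (k + 1)%:R by rewrite ltr0n; lia.
have K20 : (0 : R) < (2 * (k + 1))%:R by rewrite ltr0n; lia.
(* Half of [n / (k + 1)]: then [d >= 2 * x] and [k <= x], so [d - k >= x]. *)
pose x : R := n%:R / (2 * (k + 1))%:R.
have nx : n%:R = (2 * (k + 1))%:R * x.
  by rewrite /x mulrC divfK // lt0r_neq0.
have kx : k%:R <= x by rewrite /x ler_pdivlMr // -natrM ler_nat; lia.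
have x0 : 0 < x by apply: lt_le_trans kx; rewrite ltr0n; lia.
have xd : x + x <= d%:R.
  rewrite -(ler_pM2l K0); apply: le_trans nd; rewrite nx natrM; lra.
have kd : (k <= d)%N by rewrite -(ler_nat R); lra.
have xm : x <= (d - k)%:R by rewrite natrB //; lra.
rewrite -(ler_pM2r (exprn_gt0 (k - 2) x0)).
apply: (@le_trans _ _ (F%:R * (d - k)%:R ^+ (k - 2))).
  by rewrite ler_wpM2l ?ler0n // lerXn2r ?nnegrE ?ler0n ?(ltW x0).
rewrite -natrX -natrM; move: le; rewrite -(ler_nat R) => /le_trans; apply.
rewrite natrM; apply: le_trans (ler_wpM2r (ler0n _ _) Nle) _.
apply: (@le_trans _ _ (eps * n%:R ^+ (k - 1))).
  rewrite -mulrA ler_pM2l // -natrM -natrX ler_nat.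
  apply: leq_trans (bin_fact_le _ _) _.
  by rewrite leq_exp2r ?leq_subr //; lia.
have -> : (k - 1 = (k - 2).+1)%N by lia.
by rewrite exprS {2}nx exprMn !mulrA.
Qed.

(** * Small monochromatic components contradict the degree condition *)

Theorem theorem5p1 (R : realType) (k n : nat) (eps : R)
    (T : finType) (G : {set {set T}})
    (hk : (3 <= k)%N) (hkn : (k <= n)%N)
    (heps0 : 0 < eps)
    (heps1 : eps < 1 / (k%:R ^+ (5 * k) * 2%:R ^+ (8 * k)))
    (hT : #|T| = n) (hG : uniform k G)
    (hdeg : (1 - eps) * 'C(n - 1, k - 1)%:R <= (min_degree G)%:R) :
  (k%:R / (k + 1)%:R - Num.sqrt (k%:R ^+ k * eps)) * n%:R
    <= (mcr (k + 1) G)%:R :> R.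
Proof.
set alpha := Num.sqrt _.
have k0 : (0 < k)%N by apply: leq_trans hk.
have T0 : (0 < #|T|)%N by rewrite hT (leq_trans k0).
have n0 : (0 : R) < n%:R by rewrite ltr0n (leq_trans k0).
have K0 : (0 : R) < (k + 1)%:R by rewrite ltr0n addn1.
have an0 : 0 <= alpha * n%:R by rewrite mulr_ge0 ?sqrtr_ge0 ?ltW.
pose B : R := k%:R / (k + 1)%:R * n%:R.
have BK : (k + 1)%:R * B = k%:R * n%:R 
  by rewrite /B mulrA [_ * (_ / _)]mulrC divfK ?lt0r_neq0.
have Bn : B <= n%:R.
  by rewrite /B ler_piMl ?(ltW n0) // ler_pdivrMr // mul1r ler_nat leq_addr.
rewrite mulrBl -/B.
suff key (chi : {ffun {set T} -> 'I_(k + 1)}) : B - alpha * n%:R <= (mc G chi)%:R.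
  (* The initial value [#|T|] of the minimum also satisfies the bound, since [B <= n]. *)
  apply: (big_ind (fun m => B - alpha * n%:R <= m%:R)) => [|x y hx hy|chi _].
  - by rewrite hT; lra.
  - by rewrite /minn; case: ifP.
  - exact: key.
rewrite leNgt; apply/negP; set M := mc G chi => ltM.
have leM : (n%:R - M%:R : R) <= (n - M)%:R.
  by rewrite lerBlDr -natrD ler_nat addnC -leq_subLR.
pose L := color_comp G chi; pose far u := [set v | (2 < hdist (L u) (L v))%N].
have Ik : #|'I_(k + 1)| = k.+1 by rewrite card_ord addn1.
have mono e : e \in G -> exists i, ~~ split_by L i e.
  exact: not_split_by_color_comp.
have LM i C : (n - M <= #|[set v | L v i != C]|)%N.
  by rewrite -hT card_color_comp_neq.
have missing u : #|nonedges k G [set u]|%:R <= eps * 'C(n - 1, k - 1)%:R.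
  have := card_nonedges_degree T k G u k0 hG; rewrite hT => eC.
  have : (min_degree G)%:R <= (degree G u)%:R :> R by rewrite ler_nat min_degree_le.
  move: hdeg; rewrite -eC.
  by rewrite natrD; lra.
have farP u : 4%:R * #|far u|%:R <= alpha * n%:R.
  (* For small [n] the bound on [eps] excludes every non-edge at [u]. Otherwise
     [n - M >= n / (k + 1) >= 2 * k], which leaves enough room to count non-edges. *)
  have [small|large] := ltnP n (2 * k * (k + 1)).
    suff -> : #|far u| = 0%N by rewrite mulr0.
    apply: (far_eq0 _ _ _ L k G u Ik hk); rewrite ?hT //.
      move=> i; apply: leq_trans (LM i _); rewrite -(ltr_nat R).
      by apply: lt_le_trans leM; lra.
    apply/eqP; rewrite -cards_eq0 -leqn0 -ltnS -(ltr_nat R).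
    apply: le_lt_trans (missing u) _.
    move: heps1; rewrite ltr_pdivlMr; last first.
      by rewrite mulr_gt0 ?exprn_gt0 ?ltr0n.
    apply: le_lt_trans; rewrite ler_pM2l // -!natrX -natrM ler_nat.
    exact: bin_le_of_small.
  have nM : n%:R <= (k + 1)%:R * (n - M)%:R :> R.
    apply: le_trans (ler_wpM2l (ltW K0) leM); rewrite mulrBr.
    have : (k + 1)%:R * M%:R <= (k + 1)%:R * B by rewrite ler_pM2l //; lra.
    by rewrite BK natrD; lra.
  have knM : (k <= n - M)%N.
    rewrite -(leq_pmul2l (ltn0Sn k)) -addn1; move: nM; rewrite -natrM ler_nat.
    apply: leq_trans; apply: leq_trans large.
    by rewrite [((k + 1) * k)%N]mulnC leq_mul2r leq_pmull ?orbT.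
  have := card_far_le _ _ _ L k (n - M - k) G u Ik hk mono.
  rewrite subnK // => /(_ (fun i => LM i _)); rewrite -/(far u) => le.
  have leF := le_of_large R k n (n - M) #|far u| _ eps hk large heps0 nM le (missing u).
  have := eps_pow_le_sqrt R k eps hk heps0 heps1; rewrite -/alpha.
  move=> /(ler_wpM2r (ltW n0)); apply: le_trans.
  apply: le_trans (ler_wpM2l (ler0n _ 4) leF) _.
  by rewrite le_eqVlt; apply/orP; left; apply/eqP; ring.
pose b := (\max_u #|far u|)%N.
have bP : 4%:R * b%:R <= alpha * n%:R.
  by rewrite /b; have [u ->] := bigop.eq_bigmax (fun u => #|far u|) T0.
have : (#|'I_(k + 1)| * (n - M) <= #|T| + 4 * #|'I_(k + 1)| * b)%N.
  apply: (card_le_of_near_words _ _ _ L) => // [|u]; first by rewrite Ik.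
  exact: bigop.leq_bigmax.
rewrite card_ord hT -(ler_nat R) natrD !natrM => le.
(* The count yields [(k + 1) * (n - M) <= n + (k + 1) * alpha * n], hence [M >= B - alpha * n],
   against [ltM]. *)
have lo := ler_wpM2l (ltW K0) leM.
have hi := ler_wpM2l (ltW K0) bP.
have : (k + 1)%:R * M%:R < (k + 1)%:R * (B - alpha * n%:R) by rewrite ltr_pM2l.
rewrite mulrBr BK; move: lo hi le; rewrite mulrBr.
have -> : (k + 1)%:R * n%:R = k%:R * n%:R + n%:R :> R by rewrite natrD; ring.
lra.
Qed.
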